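(* Let $\mathbf{A}=(A,\mu,\alpha)$ be a system whose state $\mu$ is a trace, and let $\mathbf{F}=(F,\lambda,\varphi)$ be a subsystem of $\mathbf{A}$. Then $\mathbf{A}$ is weakly mixing relative to $\mathbf{F}$ if and only if \[ \lim_{N\to\infty}\frac1N\sum_{n=1}^N\lambda\left(|D(a^*\alpha^n(a))|^2\right)=0 \] for all $a\in A$ such that $D(a)=0$.
   Context: A system $\mathbf{A}=(A,\mu,\alpha)$ consists of a faithful normal state $\mu$ on a von Neumann algebra $A$ and a $*$-automorphism $\alpha$ of $A$ with $\mu\circ\alpha=\mu$. A system $\mathbf{F}=(F,\lambda,\varphi)$ is a subsystem of $\mathbf{A}$ if $F$ is a von Neumann subalgebra of $A$ containing the unit of $A$, $\mu|_F=\lambda$ and $\alpha|_F=\varphi$ (so $\alpha(F)=F$). It is a modular subsystem if moreover $F$ is globally invariant under the modular group associated to $\mu$; when $\mu$ is a trace every subsystem is modular. For a modular subsystem, $D:A\to F$ denotes the unique conditional expectation with $\lambda\circ D=\mu$. Write $|x|^2=x^*x$. $\mathbf{A}$ is weakly mixing relative to the modular subsystem $\mathbf{F}$ if $\lim_{N\to\infty}\frac1N\sum_{n=1}^N\lambda(|D(b\alpha^n(a))|^2)=0$ for all $a,b\in A$ with $D(a)=D(b)=0$. *)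

(* Defs.v *)
(* Dynamical systems on von Neumann algebras. A von Neumann algebra is taken
   concretely, as a set of bounded operators on a complex Hilbert space;
   functionals and maps on it are total functions of which only the values on
   the algebra are ever constrained or used. *)
From HB Require Import structures.
From mathcomp Require Import all_boot all_order all_algebra complex.
From mathcomp Require Import all_classical all_reals all_analysis.

Set Implicit Arguments.
Unset Strict Implicit.
Unset Printing Implicit Defensive.

Import Order.TTheory GRing.Theory Num.Theory numFieldNormedType.Exports.

Local Open Scope classical_set_scope.
Local Open Scope ring_scope.

(* The inner product is linear in its first argument and conjugate-linear in
   the second. *)
Record hilbertType (R : realType) := Hilbert {
  hilbert_space :> completeNormedModType R[i];
  inner : {dot hilbert_space for Num.conj};
  inner_normE : forall x : hilbert_space, inner x x = `|x| ^+ 2 }.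

Section Operators.
Variables (R : realType) (H : hilbertType R).
Implicit Types (a b s t T : H -> H) (A P S : set (H -> H)).

Definition bounded_operator T : Prop := linear T /\ continuous T.

Definition is_adjoint a b : Prop := forall x y, inner H (a x) y = inner H x (b y).

(* Choice picks the adjoint, which is unique when it exists; it exists for
   every bounded operator, and explicitly so in a von Neumann algebra by
   [vn_adjoint] below. *)
Definition adjoint a : H -> H := get [set b | is_adjoint a b].

Definition abs_sq a : H -> H := adjoint a \o a.

Definition self_adjoint a : Prop := is_adjoint a a.

Definition op_ge0 a : Prop := forall x, 0 <= inner H (a x) x.

Definition op_le a b : Prop := op_ge0 (b - a).

Definition commutant S : set (H -> H) :=
  [set T | bounded_operator T /\ forall a, S a -> T \o a = a \o T].

Record von_neumann_algebra A : Prop := {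
  vn_bounded : forall a, A a -> bounded_operator a;
  vn_unit : A idfun;
  vn_linear : forall (c : R[i]) a b, A a -> A b -> A (c *: a + b);
  vn_mul : forall a b, A a -> A b -> A (a \o b);
  vn_adjoint : forall a, A a -> exists2 b, A b & is_adjoint a b;
  vn_bicommutant : commutant (commutant A) = A }.

Definition directed P : Prop :=
  forall a b, P a -> P b -> exists c, [/\ P c, op_le a c & op_le b c].

Definition is_op_sup A P s : Prop :=
  [/\ A s, self_adjoint s, forall a, P a -> op_le a s &
      forall t, A t -> self_adjoint t -> (forall a, P a -> op_le a t) ->
        op_le s t].

(* The order of [R[i]] compares complex numbers with real difference only, so
   [0 <= z] says that [z] is real and nonnegative, and [supremums] is the usual
   notion on the real values of a positive functional. *)
Definition normal A (mu : (H -> H) -> R[i]) : Prop :=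
  forall P s, P `<=` A -> P !=set0 -> (forall a, P a -> self_adjoint a) ->
    directed P -> is_op_sup A P s -> supremums (mu @` P) (mu s).

Record faithful_normal_state A (mu : (H -> H) -> R[i]) : Prop := {
  state_linear : forall (c : R[i]) a b, A a -> A b ->
    mu (c *: a + b) = c * mu a + mu b;
  state_ge0 : forall a, A a -> op_ge0 a -> 0 <= mu a;
  state_unit : mu idfun = 1;
  state_normal : normal A mu;
  state_faithful : forall a, A a -> mu (abs_sq a) = 0 -> a = 0 }.

Record star_automorphism A (alpha : (H -> H) -> H -> H) : Prop := {
  aut_bij : set_bij A A alpha;
  aut_linear : forall (c : R[i]) a b, A a -> A b ->
    alpha (c *: a + b) = c *: alpha a + alpha b;
  aut_mul : forall a b, A a -> A b -> alpha (a \o b) = alpha a \o alpha b;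
  aut_adjoint : forall a, A a -> alpha (adjoint a) = adjoint (alpha a) }.

End Operators.

Record system (R : realType) (H : hilbertType R) := System {
  alg : set (H -> H);
  state : (H -> H) -> R[i];
  aut : (H -> H) -> H -> H;
  system_alg : von_neumann_algebra alg;
  system_state : faithful_normal_state alg state;
  system_aut : star_automorphism alg aut;
  system_invariant : forall a, alg a -> state (aut a) = state a }.

Section Systems.
Variables (R : realType) (H : hilbertType R).
Implicit Types (A F : system H) (D : (H -> H) -> H -> H).

Definition tracial A : Prop :=
  forall a b, alg A a -> alg A b -> state A (a \o b) = state A (b \o a).

(* Both algebras act on [H] and contain its identity operator, so that the
   units agree. *)
Definition subsystem F A : Prop :=
  [/\ alg F `<=` alg A,
      forall x, alg F x -> state A x = state F x &
      forall x, alg F x -> aut A x = aut F x].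

Record conditional_expectation A F D : Prop := {
  cexp_in : forall a, alg A a -> alg F (D a);
  cexp_linear : forall (c : R[i]) a b, alg A a -> alg A b ->
    D (c *: a + b) = c *: D a + D b;
  cexp_ge0 : forall a, alg A a -> op_ge0 a -> op_ge0 (D a);
  cexp_id : forall x, alg F x -> D x = x;
  cexp_bimodule : forall x a y, alg F x -> alg A a -> alg F y ->
    D (x \o a \o y) = x \o D a \o y }.

Definition state_preserving A F D : Prop :=
  forall a, alg A a -> state F (D a) = state A a.

Definition cesaro_mean (u : nat -> R[i]) (N : nat) : R[i]^o :=
  N%:R^-1 * \sum_(1 <= n < N.+1) u n.

(* [D] stands for the conditional expectation of [A] onto [F] preserving the
   states. *)
Definition weakly_mixing_relative A F D : Prop :=
  forall a b, alg A a -> alg A b -> D a = 0 -> D b = 0 ->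
    cesaro_mean (fun n => state F (abs_sq (D (b \o iter n (aut A) a))))
      @ \oo --> (0 : R[i]^o).

End Systems.

(* Main.v *)
Require Import Defs.
From HB Require Import structures.
From mathcomp Require Import all_boot all_order all_algebra complex.
From mathcomp Require Import all_classical all_reals all_analysis.
From mathcomp Require Import ring.

Set Implicit Arguments.
Unset Strict Implicit.
Unset Printing Implicit Defensive.

Import Order.TTheory GRing.Theory Num.Theory numFieldNormedType.Exports.
Local Open Scope classical_set_scope.
Local Open Scope ring_scope.

(** Write [tau] for the trace and [|x|^2] for [star x * x].

    One direction is the case [b = star a], because the conditional
    expectation commutes with the adjoint ([exp_star]).

    For the other direction, let [e] be the Jones projection of [D]. In the
    basic construction, with its canonical trace, [tau |D (b x)|^2] is the
    Hilbert-Schmidt inner product of [star b e b] and [x e (star x)]. The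
    operators [u n = alpha^n(a) e (star (alpha^n(a)))] therefore form a
    stationary sequence whose correlations are the numbers
    [c k = tau |D (star a * alpha^k(a))|^2]. These are nonnegative, and by
    hypothesis they tend to [0] in mean; hence the averages of the [u n] tend
    to [0] in norm, and by Cauchy-Schwarz so do their inner products with the
    fixed vector [star b e b], which is the claim.

    The basic construction itself can be bypassed. The Cauchy-Schwarz
    inequality that is needed,
      [(sum_i tau |D (b a_i)|^2)^2
         <= K^2 * sum_ij tau |D (star a_i * a_j)|^2]
    where [K] bounds [|b|^2], is proved inside the algebra
    ([sum_sqnorm_exp_le]). Put [d_i = D (b a_i)], [w = sum_i a_i (star d_i)]
    and [T = D (b w) = sum_i d_i (star d_i)], which is self-adjoint with
    [tau T = sum_i tau |d_i|^2]. Then [tau |T|^2 <= tau |b w|^2 <= K tau |w|^2],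
    while expanding [tau |w|^2] and separating the factors
    [D (star a_i * a_j)] from the factors [(star d_j) d_i] by Cauchy-Schwarz
    bounds [tau |w|^2] by the geometric mean of the right-hand double sum and
    [tau |T|^2] itself; so [tau |T|^2] is at most the right-hand side, and
    [(tau T)^2 <= tau |T|^2]. Only the fixed operator [b] is bounded here,
    so nothing has to be known about the operator norms of the iterates
    [alpha^n(a)].

    With [a_i = alpha^i(a)] stationarity ([sqnorm_exp_stationary]) turns the
    double sum over [1..N] into [sum_ij c |i - j| <= 2 N sum_(k <= N) c k],
    and division by [N^2] finishes the proof ([cesaro_mean_cvg0]).

    The algebraic part is carried out in an abstract star-algebra with a
    faithful tracial state; the operators of a von Neumann algebra are then
    given the structure of such an algebra. *)

(** * Tracial star-algebras with a conditional expectation *)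

Record tracial_star_algebra (C : numClosedFieldType) (M : algType C)
    (star : M -> M) (tau : M -> C) : Prop := {
  starZ : forall c x, star (c *: x) = c^* *: star x;
  starM : forall x y, star (x * y) = star y * star x;
  starK : involutive star;
  trace_ge0 : forall x, 0 <= tau (star x * x);
  trace1 : tau 1 = 1;
  traceC : forall x y, tau (x * y) = tau (y * x);
  trace_faithful : forall x, tau (star x * x) = 0 -> x = 0 }.

(** The subalgebra onto which [D] projects does not appear: it is the set of
    fixed points of [D], equivalently the range of [D]. *)
Record star_expectation (C : numClosedFieldType) (M : algType C)
    (star : M -> M) (tau : M -> C) (D : M -> M) : Prop := {
  expK : forall x, D (D x) = D x;
  exp_star_fixed : forall x, D (star (D x)) = star (D x);
  expMl : forall x y, D (D x * y) = D x * D y;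
  expMr : forall x y, D (x * D y) = D x * D y;
  trace_exp : forall x, tau (D x) = tau x }.

(** The range of [D] is required to be invariant under [alpha] and under its
    inverse, which is what makes [alpha] commute with [D]. *)
Record exp_star_automorphism (C : numClosedFieldType) (M : algType C)
    (star : M -> M) (tau : M -> C) (D alpha : M -> M) : Prop := {
  autM : forall x y, alpha (x * y) = alpha x * alpha y;
  aut_star : forall x, alpha (star x) = star (alpha x);
  trace_aut : forall x, tau (alpha x) = tau x;
  aut_fixed : forall x, D (alpha (D x)) = alpha (D x);
  aut_onto : forall y, exists x, D y = alpha (D x) }.

Section StarAlgebra.
Variables (C : numClosedFieldType) (M : algType C).
Variables (star : {additive M -> M}) (tau : {scalar M}) (D : {linear M -> M}).
Hypotheses (tsa : tracial_star_algebra star tau).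
Hypotheses (sexp : star_expectation star tau D).
Implicit Types x y z b w : M.

Local Notation sqnorm x := (tau (star x * x)).

Lemma star1 : star 1 = 1.
Proof.
by rewrite -[star 1]mul1r -{1}[1](starK tsa) -(starM tsa) mul1r (starK tsa).
Qed.

(** Polarization: [tau |1 + x|^2] and [tau |1 + i x|^2] are real, which makes
    [tau x + tau (star x)] and [i (tau x - tau (star x))] real. *)
Lemma trace_star x : tau (star x) = (tau x)^*.
Proof.
have realsq y : (sqnorm y)^* = sqnorm y by apply/CrealP/ger0_real/(trace_ge0 tsa).
have sq1D y : sqnorm (1 + y) = 1 + tau y + tau (star y) + sqnorm y.
  rewrite raddfD /= star1 mulrDl !mulrDr !mul1r !mulr1 !linearD /= (trace1 tsa).
  by ring.
have re : (tau x + tau (star x))^* = tau x + tau (star x).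
  have -> : tau x + tau (star x) = sqnorm (1 + x) - 1 - sqnorm x.
    by rewrite sq1D; ring.
  by rewrite !rmorphB /= !realsq rmorph1.
have im : ('i * (tau x - tau (star x)))^* = 'i * (tau x - tau (star x)).
  have -> : 'i * (tau x - tau (star x)) = sqnorm (1 + 'i *: x) - 1 - sqnorm ('i *: x).
    by rewrite sq1D (starZ tsa) !linearZ /= conjCi; ring.
  by rewrite !rmorphB /= !realsq rmorph1.
move: im; rewrite rmorphM rmorphB /= conjCi mulNr -mulrN => /(mulfI (neq0Ci C)) im.
move: re; rewrite rmorphD /= => re.
have two0 : (2 : C) != 0 by rewrite pnatr_eq0.
apply: (mulfI two0).
transitivity ((tau x + tau (star x)) - (tau x - tau (star x))); first by ring.
by rewrite -re -im; ring.
Qed.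

Lemma trace_expM x y : tau (x * D y) = tau (D x * D y).
Proof. by rewrite -(trace_exp sexp) (expMr sexp). Qed.

(** By faithfulness, an element of the range of [D] is determined by its inner
    products with the range, and [D] is the orthogonal projection onto it. *)
Lemma exp_eq x z : D z = z ->
  (forall y, tau (star (D y) * x) = tau (star (D y) * z)) -> D x = z.
Proof.
move=> Dz xz; apply/eqP; rewrite -subr_eq0; apply/eqP/(trace_faithful tsa).
have -> : D x - z = D (x - z) by rewrite linearB /= Dz.
rewrite {2}linearB /= Dz mulrBr linearB /= -xz -[in X in X - _](exp_star_fixed sexp).
rewrite -(expMl sexp) (exp_star_fixed sexp) (trace_exp sexp); exact: subrr.
Qed.

Lemma exp_star x : D (star x) = star (D x).
Proof.
apply: exp_eq; first exact: (exp_star_fixed sexp).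
move=> y; rewrite -!(starM tsa) !trace_star; congr (_^*).
by rewrite trace_expM -(expMr sexp) (trace_exp sexp).
Qed.

(** Pythagoras: the difference of the two sides is [tau |x - D x|^2]. *)
Lemma sqnorm_exp_le x : sqnorm (D x) <= sqnorm x.
Proof.
rewrite -subr_ge0; have := trace_ge0 tsa (x - D x); congr (0 <= _).
rewrite raddfB /= mulrBl !mulrBr !linearB /= (trace_expM (star x)) exp_star.
have -> : tau (star (D x) * x) = sqnorm (D x).
  by rewrite -(exp_star x) -[LHS](trace_exp sexp) (expMl sexp).
ring.
Qed.

(** The variance [tau |x - tau x|^2] is nonnegative. *)
Lemma trace_sqr_le x : tau x * (tau x)^* <= sqnorm x.
Proof.
rewrite -subr_ge0; have := trace_ge0 tsa (x - tau x *: 1); congr (0 <= _).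
rewrite raddfB /= (starZ tsa) star1 mulrBl !mulrBr -!scalerAr -!scalerAl !mul1r !mulr1.
rewrite !linearB /= !linearZ /= (trace1 tsa) trace_star.
rewrite /GRing.scale /=; ring.
Qed.

(** Cauchy-Schwarz for [star x] and [y] in the form of the inequality between
    arithmetic and geometric means, which can be summed term by term. *)
Lemma trace_amgm (t : C) x y : t \is Num.real ->
  t * (tau (x * y) + (tau (x * y))^*) <= t ^+ 2 * sqnorm x + sqnorm y.
Proof.
move=> /CrealP tR; rewrite -subr_ge0.
have := trace_ge0 tsa (t *: star x - y); congr (0 <= _).
rewrite raddfB /= (starZ tsa) (starK tsa) tR mulrBl !mulrBr -!scalerAr -!scalerAl.
rewrite !linearB /= !linearZ /= -trace_star (starM tsa) (traceC tsa x (star x)).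
rewrite /GRing.scale /=; ring.
Qed.

(** This is the Cauchy-Schwarz inequality between [star b e b] and the sum of
    the [a_i e (star a_i)] in the basic construction, with [e] the Jones
    projection, except that [K ^+ 2] replaces the slightly better constant
    [tau |D (b * star b)|^2]. *)
Lemma sum_sqnorm_exp_le (I : Type) (r : seq I) (a : I -> M) b (K : C) :
  0 <= K -> (forall w, sqnorm (b * w) <= K * sqnorm w) ->
  (\sum_(i <- r) sqnorm (D (b * a i))) ^+ 2 <=
  K ^+ 2 * \sum_(i <- r) \sum_(j <- r) sqnorm (D (star (a i) * a j)).
Proof.
move=> K0 bK; pose d i := D (b * a i).
pose w := \sum_(i <- r) a i * star (d i); pose T := D (b * w).
set S := \sum_(i <- r) _; set G := \sum_(i <- r) _.
have S0 : 0 <= S by apply: sumr_ge0 => i _; exact: (trace_ge0 tsa).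
have TE : T = \sum_(i <- r) d i * star (d i).
  rewrite /T mulr_sumr linear_sum; apply: eq_bigr => i _ /=.
  by rewrite mulrA -(exp_star_fixed sexp) (expMr sexp).
have trT : tau T = S.
  by rewrite TE linear_sum; apply: eq_bigr => i _; rewrite /= (traceC tsa).
have starT : star T = T.
  rewrite TE raddf_sum; apply: eq_bigr => i _ /=.
  by rewrite (starM tsa) (starK tsa).
have sqT : sqnorm T = \sum_(i <- r) \sum_(j <- r) sqnorm (star (d j) * d i).
  rewrite starT {1}TE mulr_suml linear_sum exchange_big; apply: eq_bigr => i _ /=.
  rewrite TE mulr_sumr linear_sum; apply: eq_bigr => j _ /=.
  by rewrite (starM tsa) (starK tsa) -!mulrA [RHS](traceC tsa) -!mulrA.
have wE : sqnorm w =
    \sum_(i <- r) \sum_(j <- r) tau (D (star (a i) * a j) * (star (d j) * d i)).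
  rewrite /w raddf_sum mulr_suml linear_sum; apply: eq_bigr => i _ /=.
  rewrite mulr_sumr linear_sum; apply: eq_bigr => j _ /=.
  have dK k : D (d k) = d k by rewrite /d (expK sexp).
  transitivity (tau (star (a i) * a j * (star (d j) * d i))).
    by rewrite (starM tsa) (starK tsa) -mulrA (traceC tsa) !mulrA.
  rewrite -(trace_exp sexp) -[in LHS]dK -[in LHS](dK i) -exp_star mulrA.
  by rewrite !(expMr sexp) exp_star !dK mulrA.
have Qle : sqnorm T <= K * sqnorm w by apply: le_trans (bK w); exact: sqnorm_exp_le.
have Wle : K * (2 * sqnorm w) <= K ^+ 2 * G + sqnorm T.
  have /CrealP wR : sqnorm w \is Num.real by apply/ger0_real/(trace_ge0 tsa).
  have -> : 2 * sqnorm w = sqnorm w + (sqnorm w)^* by rewrite wR; ring.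
  rewrite wE rmorph_sum -big_split /= mulr_sumr sqT mulr_sumr -big_split /=.
  apply: ler_sum => i _; rewrite rmorph_sum -big_split !mulr_sumr -big_split /=.
  by apply: ler_sum => j _; apply: trace_amgm; exact: ger0_real.
(* [Qle] and [Wle] give [2 Q <= 2 K W <= K^2 G + Q] for [Q = tau |T|^2] and
   [W = tau |w|^2], hence [Q <= K^2 G]. *)
have /CrealP SR : S \is Num.real by exact: ger0_real.
have := trace_sqr_le T; rewrite trT SR -expr2 => /le_trans; apply.
rewrite -(lerD2r (sqnorm T)); apply: le_trans Wle.
have -> : K * (2 * sqnorm w) = K * sqnorm w + K * sqnorm w by ring.
exact: lerD.
Qed.

Variables (alpha : M -> M) (saut : exp_star_automorphism star tau D alpha).

(** [D] is determined by the trace and by its range, and [alpha] preserves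
    both. *)
Lemma exp_aut x : D (alpha x) = alpha (D x).
Proof.
apply: exp_eq => [|y]; first exact: (aut_fixed saut).
have [z ->] := aut_onto saut y.
rewrite -(aut_star saut) -!(autM saut) !(trace_aut saut).
by rewrite -exp_star -[LHS](trace_exp sexp) (expMl sexp).
Qed.

Lemma sqnorm_exp_iter n x y :
  sqnorm (D (star (iter n alpha x) * iter n alpha y)) = sqnorm (D (star x * y)).
Proof.
elim: n => //= n IHn.
rewrite -(aut_star saut) -(autM saut) exp_aut -(aut_star saut) -(autM saut).
by rewrite (trace_aut saut).
Qed.

Lemma sqnorm_expC x y : sqnorm (D (star x * y)) = sqnorm (D (star y * x)).
Proof.
have -> : star y * x = star (star x * y) by rewrite (starM tsa) (starK tsa).
by rewrite exp_star (starK tsa) (traceC tsa).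
Qed.

(** In truncated subtraction one of the two summands of the exponent vanishes,
    and the exponent is [|m - n|]. *)
Lemma sqnorm_exp_stationary m n x :
  sqnorm (D (star (iter m alpha x) * iter n alpha x)) =
  sqnorm (D (star x * iter ((m - n) + (n - m)) alpha x)).
Proof.
wlog mn : m n / (m <= n)%N => [IH|].
  by case/orP: (leq_total m n) => mn; [|rewrite sqnorm_expC addnC]; exact: IH.
rewrite -[in LHS](subnKC mn) (iterD m) sqnorm_exp_iter.
by move: mn; rewrite -subn_eq0 => /eqP ->.
Qed.

End StarAlgebra.

(** * Convergence in mean *)

(** For fixed [m], every distance from [m] occurs at most twice. *)
Lemma sum_dist_le (C : numDomainType) (c : nat -> C) N : (forall n, 0 <= c n) ->
  \sum_(1 <= m < N.+1) \sum_(1 <= n < N.+1) c ((m - n) + (n - m))%N <=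
  N%:R * (2 * \sum_(0 <= k < N.+1) c k).
Proof.
move=> c0; set s := \sum_(0 <= k < N.+1) c k.
have sum_le p q : (q <= N.+1)%N -> \sum_(p <= k < q) c k <= s.
  move=> qN; case: (leqP p q) => pq; last by rewrite big_geq ?sumr_ge0// ltnW.
  rewrite /s [leRHS](big_cat_nat (n := p)) ?(leq_trans pq)//=.
  by rewrite (big_cat_nat (n := q) pq qN)/= addrCA lerDl addr_ge0 ?sumr_ge0.
have -> : N%:R * (2 * s) = \sum_(1 <= m < N.+1) (s + s).
  by rewrite sumr_const_nat subSS subn0 !mulr_natl mulr2n.
rewrite big_nat_cond [leRHS]big_nat_cond; apply: ler_sum => m.
rewrite andbT => /andP[m1 mN].
(* Left of the diagonal the distance is [m - n], so that the summation has to
   be reversed; from the diagonal on it is [n - m]. *)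
rewrite (big_cat_nat (n := m)) ?(ltnW mN)//=; apply: lerD.
  rewrite big_nat_rev /=.
  rewrite (eq_big_nat _ _ (F2 := c)) => [|i /andP[_ im]].
    exact: sum_le (ltnW mN).
  by rewrite add1n subSS (subKn (ltnW im)) subnAC subnn sub0n addn0.
rewrite -{1}[m]add0n big_addn (eq_big_nat _ _ (F2 := c)) => [|i _].
  by apply: sum_le; exact: leq_subr.
by rewrite addnK (eqP (leq_addl i m)).
Qed.

Section CesaroMeans.
Variable R : realType.
Implicit Types u v : nat -> R[i].

Lemma cvg_natV_complex :
  (fun N : nat => (N%:R^-1 : R[i]^o)) @ \oo --> (0 : R[i]^o).
Proof.
apply/cvgr0Pnorm_lt => e e0.
near=> N.
have N0 : (0 < N)%N by near: N; exact: nbhs_infty_gt.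
rewrite ger0_norm ?invr_ge0// -[ltRHS]invrK ltf_pV2 ?posrE ?invr_gt0 ?ltr0n//.
have -> : e^-1 = (complex.Re e^-1)%:C%C by rewrite RRe_real// realV ger0_real// ltW.
rewrite -(rmorph_nat (real_complex R)) ltcR.
by near: N; exact: nbhs_infty_gtr.
Unshelve. all: by end_near. Qed.

Lemma cvg_sqr0 u v :
  (forall n, u n ^+ 2 <= v n) -> (forall n, 0 <= u n) ->
  (v : nat -> R[i]^o) @ \oo --> (0 : R[i]^o) ->
  (u : nat -> R[i]^o) @ \oo --> (0 : R[i]^o).
Proof.
move=> uv u0 /cvgr0Pnorm_lt v0; apply/cvgr0Pnorm_lt => e e0.
near=> N.
rewrite ger0_norm// -(@ltr_pXn2r _ 2)// ?nnegrE ?(ltW e0)//.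
apply: le_lt_trans (uv N) _.
have vN : 0 <= v N by apply: le_trans (uv N); exact: exprn_ge0.
rewrite -[ltLHS]ger0_norm//.
by near: N; apply: v0; exact: exprn_gt0.
Unshelve. all: by end_near. Qed.

(** Division by [N^2] bounds the square of the mean of [u] by
    [2 K (c 0 / N + cesaro_mean c N)]; the term [c 0 / N] appears because the
    Cesaro mean starts at [k = 1]. *)
Lemma cesaro_mean_cvg0 u c K : (forall n, 0 <= u n) ->
  (forall N, (\sum_(1 <= n < N.+1) u n) ^+ 2 <=
     K * (N%:R * (2 * \sum_(0 <= k < N.+1) c k))) ->
  cesaro_mean c @ \oo --> (0 : R[i]^o) -> cesaro_mean u @ \oo --> (0 : R[i]^o).
Proof.
move=> u0 uc c0.
pose v N : R[i]^o := (K * 2) *: (c 0 *: N%:R^-1 + cesaro_mean c N).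
apply: (@cvg_sqr0 _ v) => [N|N|].
- rewrite /cesaro_mean exprMn.
  have := ler_wpM2l (_ : 0 <= N%:R^-1 ^+ 2) (uc N); rewrite exprn_ge0 ?invr_ge0//.
  move=> /(_ isT)/le_trans; apply.
  rewrite /v /cesaro_mean /GRing.scale /= big_ltn//.
  case: N => [|N]; first by rewrite big_geq// invr0 !(mulr0, mul0r, addr0).
  have : N.+1%:R != 0 :> R[i] by rewrite pnatr_eq0.
  by move: (N.+1%:R : R[i]) => t t0; rewrite le_eqVlt; apply/orP; left; apply/eqP; field.
- by rewrite mulr_ge0 ?invr_ge0 ?sumr_ge0.
have scale0 (t : R[i]) (w : nat -> R[i]^o) : w @ \oo --> (0 : R[i]^o) ->
    (fun N => t *: w N) @ \oo --> (0 : R[i]^o).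
  by move=> w0; rewrite -[X in _ --> X](scaler0 _ t); exact: cvgZl_tmp w0.
apply: (scale0 (K * 2)); rewrite -[X in _ --> X](addr0 (0 : R[i]^o)).
exact: cvgD (scale0 (c 0) _ cvg_natV_complex) c0.
Qed.

End CesaroMeans.

(** * Adjoints of bounded operators *)

Section Adjoint.
Variables (R : realType) (H : hilbertType R).
Implicit Types (a b c : H -> H) (x y : H).

Lemma inner_conj x y : inner H x y = (inner H y x)^*.
Proof. by rewrite (hermC (inner H)) /= expr0 mul1r. Qed.

Lemma is_adjoint_sym a b : is_adjoint a b -> is_adjoint b a.
Proof. by move=> ab x y; rewrite inner_conj -ab -inner_conj. Qed.

Lemma is_adjoint_unique a b c : is_adjoint a b -> is_adjoint a c -> b = c.
Proof.
move=> ab ac; apply/funext => y; apply/eqP; rewrite -subr_eq0; apply/eqP.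
apply: contrapT => /eqP /(neq0_dnorm_gt0 (s := inner H)).
by rewrite linearB /= -ab -ac subrr ltxx.
Qed.

Lemma adjointE a b : is_adjoint a b -> adjoint a = b.
Proof.
move=> ab; apply: (@is_adjoint_unique a) => //.
exact: (getI (P := [set b | is_adjoint a b]) ab).
Qed.

Lemma is_adjoint_linear (c : R[i]) a a' b b' :
  is_adjoint a b -> is_adjoint a' b' ->
  is_adjoint (c *: a + a') (c^* *: b + b').
Proof.
move=> ab ab' x y.
rewrite -![(_ + _) _]/(_ _ + _ _) -![(_ *: _) _]/(_ *: _ _).
rewrite linearDl linearZl_LR linearDr linearZr_LR.
by rewrite /= conjCK ab ab'.
Qed.

Lemma is_adjoint_comp a a' b b' : is_adjoint a b -> is_adjoint a' b' ->
  is_adjoint (a \o a') (b' \o b).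
Proof. by move=> ab ab' x y /=; rewrite ab ab'. Qed.

Lemma bounded_op_le a : bounded_operator a ->
  exists2 K : R[i], 0 <= K & forall x, inner H (a x) (a x) <= K * inner H x x.
Proof.
move=> [lin /(_ 0) cont].
pose f : {linear H -> H} := HB.pack a (GRing.isLinear.Build _ _ _ _ a lin).
have /linear_boundedP/pinfty_ex_gt0[r r0 ler] := @continuous_linear_bounded _ _ _ 0 f cont.
exists (r ^+ 2) => [|x]; first by rewrite exprn_ge0// ltW.
by rewrite !inner_normE -exprMn ler_pXn2r ?nnegrE ?mulr_ge0 ?(ltW r0)// (ler x).
Qed.

End Adjoint.

(** * The star-algebra of operators of a system *)

Section OperatorAlgebra.
Variables (R : realType) (H : hilbertType R) (A : system H).

(** A type of its own for the elements of the algebra, so that it can carry the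
    structure of a complex algebra whose product is composition. *)
Definition operator := {a : H -> H | a \in alg A}.
Implicit Types x y z : operator.

Definition operator_of a (Aa : alg A a) : operator := exist _ a (mem_set Aa).

Lemma operatorP x : alg A (val x).
Proof. exact: set_mem (valP x). Qed.

HB.instance Definition _ := [Choice of operator by <:].

Let vnA := system_alg A.

Lemma alg0 : alg A 0.
Proof.
have := vn_linear vnA (-1) (vn_unit vnA) (vn_unit vnA).
by rewrite scaleN1r addNr.
Qed.

Lemma algZ c a : alg A a -> alg A (c *: a).
Proof. by move=> /(vn_linear vnA c) /(_ alg0); rewrite addr0. Qed.

Lemma algD a b : alg A a -> alg A b -> alg A (a + b).
Proof. by move=> Aa Ab; rewrite -[a]scale1r; exact: vn_linear. Qed.

Lemma algN a : alg A a -> alg A (- a).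
Proof. by rewrite -scaleN1r; exact: algZ. Qed.

Let add x y := operator_of (algD (operatorP x) (operatorP y)).
Let opp x := operator_of (algN (operatorP x)).
Let mul x y := operator_of (vn_mul vnA (operatorP x) (operatorP y)).
Let scale c x := operator_of (algZ c (operatorP x)).
Let one := operator_of (vn_unit vnA).

Fact operator_addA : associative add.
Proof. by move=> x y z; apply/val_inj/addrA. Qed.
Fact operator_addC : commutative add.
Proof. by move=> x y; apply/val_inj/addrC. Qed.
Fact operator_add0 : left_id (operator_of alg0) add.
Proof. by move=> x; apply/val_inj/add0r. Qed.
Fact operator_addN : left_inverse (operator_of alg0) opp add.
Proof. by move=> x; apply/val_inj/addNr. Qed.
HB.instance Definition _ := GRing.isZmodule.Build operator
  operator_addA operator_addC operator_add0 operator_addN.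

Fact operator_mulA : associative mul. Proof. by move=> x y z; apply/val_inj. Qed.
Fact operator_mul1 : left_id one mul. Proof. by move=> x; apply/val_inj. Qed.
Fact operator_mulx1 : right_id one mul. Proof. by move=> x; apply/val_inj. Qed.
Fact operator_mulDl : left_distributive mul +%R.
Proof. by move=> x y z; apply/val_inj. Qed.

Fact operator_linear x : linear (val x).
Proof. by case: (vn_bounded vnA (operatorP x)). Qed.
Fact operator_mulDr : right_distributive mul +%R.
Proof.
move=> x y z; apply/val_inj/funext => u /=.
by have := operator_linear x 1 (val y u) (val z u); rewrite !scale1r.
Qed.

(** The state separates the two, so that the Hilbert space cannot be zero. *)
Fact operator_one_neq0 : one != 0.
Proof.
apply/eqP => one0; have e : idfun = 0 :> (H -> H) := congr1 val one0.
have := state_linear (system_state A) (-1) alg0 alg0.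
rewrite scaler0 addr0 mulN1r addNr -e (state_unit (system_state A)).
by move/eqP; rewrite oner_eq0.
Qed.

HB.instance Definition _ := GRing.Zmodule_isNzRing.Build operator
  operator_mulA operator_mul1 operator_mulx1
  operator_mulDl operator_mulDr operator_one_neq0.

Fact operator_scaleA c d x : scale c (scale d x) = scale (c * d) x.
Proof. by apply/val_inj/scalerA. Qed.
Fact operator_scale1 : left_id 1 scale. Proof. by move=> x; apply/val_inj/scale1r. Qed.
Fact operator_scaleDr : right_distributive scale +%R.
Proof. by move=> c x y; apply/val_inj/scalerDr. Qed.
Fact operator_scaleDl x : {morph scale^~ x : c d / c + d}.
Proof. by move=> c d; apply/val_inj/scalerDl. Qed.
HB.instance Definition _ := GRing.Zmodule_isLmodule.Build R[i] operator
  operator_scaleA operator_scale1 operator_scaleDr operator_scaleDl.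

Fact operator_scaleAl c x y : c *: (x * y) = (c *: x) * y.
Proof. by apply/val_inj. Qed.
HB.instance Definition _ :=
  GRing.Lmodule_isLalgebra.Build R[i] operator operator_scaleAl.
Fact operator_scaleAr c x y : c *: (x * y) = x * (c *: y).
Proof.
apply/val_inj/funext => u /=.
pose f : {linear H -> H} :=
  HB.pack (val x) (GRing.isLinear.Build _ _ _ _ (val x) (operator_linear x)).
exact/esym/(linearZ_LR f).
Qed.
HB.instance Definition _ :=
  GRing.Lalgebra_isAlgebra.Build R[i] operator operator_scaleAr.

Definition op_state x : R[i] := state A (val x).
Fact op_state_linear : scalar op_state.
Proof. by move=> c x y; apply: (state_linear (system_state A)); exact: operatorP. Qed.
HB.instance Definition _ :=
  GRing.isLinear.Build R[i] operator R[i] *%R op_state op_state_linear.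

Fact op_adjointP x : is_adjoint (val x) (adjoint (val x)) /\ alg A (adjoint (val x)).
Proof. by have [b Ab xb] := vn_adjoint vnA (operatorP x); rewrite (adjointE xb). Qed.

Definition op_star x : operator := operator_of (op_adjointP x).2.

Lemma op_starE x y : is_adjoint (val x) (val y) -> op_star x = y.
Proof. by move=> xy; apply/val_inj/adjointE. Qed.

Lemma op_star_adj x : is_adjoint (val x) (val (op_star x)).
Proof. exact: (op_adjointP x).1. Qed.

Fact op_star_additive : zmod_morphism op_star.
Proof.
move=> x y; apply: op_starE.
have := is_adjoint_linear (-1) (op_star_adj y) (op_star_adj x).
by rewrite rmorphN1 !scaleN1r addrC [in X in is_adjoint _ X]addrC.
Qed.
HB.instance Definition _ :=
  GRing.isZmodMorphism.Build operator operator op_star op_star_additive.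

Lemma op_tracial : tracial A -> tracial_star_algebra op_star op_state.
Proof.
move=> trA; split.
- move=> c x; apply: op_starE; rewrite -[c *: x]addr0 -[_^* *: _]addr0.
  apply: (is_adjoint_linear c (op_star_adj x)) => u v.
  by rewrite linear0l linear0.
- by move=> x y; apply/op_starE/is_adjoint_comp; exact: op_star_adj.
- by move=> x; apply/op_starE/is_adjoint_sym; exact: op_star_adj.
- move=> x; apply: (state_ge0 (system_state A)); first exact: operatorP.
  move=> u /=; rewrite (is_adjoint_sym (op_star_adj x)).
  by rewrite inner_normE exprn_ge0.
- exact: (state_unit (system_state A)).
- by move=> x y; apply: trA; exact: operatorP.
- move=> x sx0; apply/val_inj/(state_faithful (system_state A)) => //; exact: operatorP.
Qed.

(** If [|x v|^2 <= K |v|^2] for all vectors [v], then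
    [star y * (K - star x * x) * y] is a positive operator. *)
Lemma op_state_mul_le x : exists2 K : R[i], 0 <= K & forall y,
  op_state (op_star (x * y) * (x * y)) <= K * op_state (op_star y * y).
Proof.
have [K K0 xK] := bounded_op_le (vn_bounded vnA (operatorP x)).
exists K => // y; rewrite -subr_ge0 -linearZ -linearB.
apply: (state_ge0 (system_state A)); first exact: operatorP.
move=> u.
rewrite -[\val _ u]/(K *: val (op_star y) (val y u) -
  val (op_star (x * y)) (val (x * y) u)).
have -> : inner H (K *: val (op_star y) (val y u) -
      val (op_star (x * y)) (val (x * y) u)) u =
    K * inner H (val y u) (val y u) - inner H (val (x * y) u) (val (x * y) u).
  rewrite linearBl linearZl_LR.
  congr (K * _ - _); exact: (is_adjoint_sym (op_star_adj _)).
rewrite subr_ge0; exact: xK.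
Qed.

End OperatorAlgebra.

(** * The conditional expectation and the dynamics on the operators *)

Section ConditionalExpectation.
Variables (R : realType) (H : hilbertType R) (A F : system H).
Variables (D : (H -> H) -> H -> H).
Hypotheses (FA : subsystem F A) (expD : conditional_expectation A F D).
Hypothesis presD : state_preserving A F D.
Implicit Types x y : operator A.

Fact alg_exp x : alg A (D (val x)).
Proof. by case: FA => sFA _ _; apply/sFA/(cexp_in expD)/operatorP. Qed.

Definition op_exp x : operator A := operator_of (alg_exp x).

Fact op_exp_linear : linear op_exp.
Proof. by move=> c x y; apply/val_inj/(cexp_linear expD); exact: operatorP. Qed.
HB.instance Definition _ :=
  GRing.isLinear.Build R[i] (operator A) (operator A) *:%R op_exp op_exp_linear.

Lemma op_exp_fixed x : op_exp x = x <-> alg F (val x).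
Proof.
split=> [<-|Fx]; first exact/(cexp_in expD)/operatorP.
exact/val_inj/(cexp_id expD).
Qed.

Lemma alg_op_exp x : alg F (val (op_exp x)).
Proof. exact/(cexp_in expD)/operatorP. Qed.

Lemma op_star_expectation :
  star_expectation (@op_star _ _ A) (@op_state _ _ A) op_exp.
Proof.
have [sFA stFA autFA] := FA; split.
- by move=> x; apply/op_exp_fixed/alg_op_exp.
- move=> x; apply/op_exp_fixed.
  have [b Fb xb] := vn_adjoint (system_alg F) (alg_op_exp x).
  by rewrite /= (adjointE xb).
- move=> x y; apply/val_inj.
  exact: (cexp_bimodule expD (alg_op_exp x) (operatorP y) (vn_unit (system_alg F))).
- move=> x y; apply/val_inj.
  exact: (cexp_bimodule expD (vn_unit (system_alg F)) (operatorP x) (alg_op_exp y)).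
- move=> x; rewrite /op_state stFA; last exact: alg_op_exp.
  exact/presD/operatorP.
Qed.

Fact alg_aut x : alg A (aut A (val x)).
Proof. by have [+ _ _] := aut_bij (system_aut A); apply; exact: operatorP. Qed.

Definition op_aut x : operator A := operator_of (alg_aut x).

Lemma op_exp_star_automorphism :
  exp_star_automorphism (@op_star _ _ A) (@op_state _ _ A) op_exp op_aut.
Proof.
have [sFA stFA autFA] := FA; have [autF _ ontoF] := aut_bij (system_aut F).
have autA := system_aut A.
split.
- by move=> x y; apply/val_inj/(aut_mul autA); exact: operatorP.
- by move=> x; apply/val_inj/(aut_adjoint autA)/operatorP.
- by move=> x; apply/system_invariant/operatorP.
- move=> x; apply/op_exp_fixed; rewrite /= autFA; last exact: alg_op_exp.
  exact/autF/alg_op_exp.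
- move=> y; have [a Fa ay] := ontoF _ (alg_op_exp y).
  exists (operator_of (sFA _ Fa)).
  have /op_exp_fixed -> : alg F (val (operator_of (sFA _ Fa))) by [].
  by apply/val_inj; rewrite /= autFA.
Qed.

Lemma val_iter_aut n x : val (iter n op_aut x) = iter n (aut A) (val x).
Proof. by elim: n => //= n ->. Qed.

(** The passage from the state of the subsystem to the trace of the large
    algebra. *)
Lemma state_abs_sq_exp x n y :
  state F (abs_sq (D (val x \o iter n (aut A) (val y)))) =
  op_state (op_star (op_exp (x * iter n op_aut y)) * op_exp (x * iter n op_aut y)).
Proof.
have [sFA stFA _] := FA.
rewrite /op_state -val_iter_aut; apply/esym/stFA.
set z := op_exp _; have Fz : alg F (val z) by exact: alg_op_exp.
apply: (vn_mul (system_alg F)) => //.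
by have [b Fb zb] := vn_adjoint (system_alg F) Fz; rewrite /= (adjointE zb).
Qed.

End ConditionalExpectation.

(** * The characterization of relative weak mixing *)

Theorem proposition3p8 (R : realType) (H : hilbertType R) (A F : system H)
    (D : (H -> H) -> H -> H) :
  tracial A -> subsystem F A ->
  conditional_expectation A F D -> state_preserving A F D ->
  weakly_mixing_relative A F D <->
  (forall a, alg A a -> D a = 0 ->
    cesaro_mean
      (fun n => state F (abs_sq (D (adjoint a \o iter n (aut A) a))))
      @ \oo --> (0 : R[i]^o)).
Proof.
move=> trA FA expD presD.
have tsa := op_tracial trA.
have sexp := op_star_expectation FA expD presD.
have saut := op_exp_star_automorphism FA expD.
split=> [wm a Aa Da0 | selfmix a b Aa Ab Da0 _].
  pose x := operator_of Aa.
  apply: wm => //; first exact: (operatorP (op_star x)).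
  have Dx0 : op_exp FA expD x = 0 by exact/val_inj.
  have := exp_star tsa sexp x; rewrite /= Dx0 raddf0.
  by move=> /(congr1 val).
pose x := operator_of Aa; pose y := operator_of Ab.
have [K K0 yK] := op_state_mul_le y.
apply: (cesaro_mean_cvg0 (K := K ^+ 2)) (selfmix a Aa Da0) => [n|N].
  rewrite (state_abs_sq_exp FA expD y n x); exact: (trace_ge0 tsa).
under eq_bigr do rewrite (state_abs_sq_exp FA expD y _ x).
apply: le_trans (sum_sqnorm_exp_le tsa sexp _ _ K0 yK) _.
apply: ler_wpM2l; first exact: exprn_ge0.
under eq_bigr => i _ do under eq_bigr => j _
  do rewrite (sqnorm_exp_stationary tsa sexp saut).
under [in leRHS]eq_bigr => k _ do rewrite (state_abs_sq_exp FA expD (op_star x) k x).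
apply: (@sum_dist_le _ (fun k => _)) => n; exact: (trace_ge0 tsa).
Qed.
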